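(* Let $L$ be a finite lattice satisfying the following conditions: (C1) $L$ has a $\{0,1\}$-sublattice $G$ (the grid), which is of the form $C\times D$, where $C$ and $D$ are finite chains. (C2) Every element of $H = L - G$ is doubly irreducible in $L$. (C3) For $x, y\in H$, if $\underline{x}=\underline{y}$, then $x=y$; and dually, if $\overline{x}=\overline{y}$, then $x=y$. (C4) For every $x\in H$, either the interval $[\underline{x},\overline{x}]_G$ is a prime interval and $[\underline{x},\overline{x}]_L$ is the three-element chain, or $[\underline{x},\overline{x}]_G$ is a prime square and $[\underline{x},\overline{x}]_L$ is an $M_3$. Here, for $x\in L$, $\underline{x}$ denotes the largest element of $G$ with $\underline{x}\leq x$, and $\overline{x}$ denotes the smallest element of $G$ with $x\leq\overline{x}$. Then $L$ is $3$-modular.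
   Context: A $\{0,1\}$-sublattice is a sublattice containing the least and greatest elements of $L$. An element is doubly irreducible if it is both join-irreducible and meet-irreducible. For $a\leq b$ in $G$, $[a,b]_G$ and $[a,b]_L$ denote the intervals computed in $G$ and in $L$, respectively. A prime interval of $G$ is a two-element interval $[a,b]_G$ (that is, $b$ covers $a$ in $G$). A prime square of $G$ is an interval of $G$ of length two isomorphic to $C_2^2$, where $C_2$ is the two-element chain. $M_3$ is the five-element modular nondistributive lattice. Define lattice polynomials in the variables $x,y,z$ by $p_0=x$, $q_0=y$, $r_0=z$, and $p_{n+1}=p_n\vee(q_n\wedge r_n)$, $q_{n+1}=q_n\vee(p_n\wedge r_n)$, $r_{n+1}=r_n\vee(p_n\wedge q_n)$. For $n>0$, a lattice is $n$-modular if it satisfies the identity $p_n=p_{n+1}$; thus $3$-modular means that $p_3=p_4$ holds identically. *)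

(* Defs.v *)
From HB Require Import structures.
From mathcomp Require Import all_boot all_order.

Set Implicit Arguments.
Unset Strict Implicit.
Unset Printing Implicit Defensive.

Import Order.TTheory.
Local Open Scope order_scope.

Variant m3 := M3bot | M3atom of 'I_3 | M3top.

Section M3.

Definition m3_code (x : m3) : option (option 'I_3) :=
  match x with
  | M3bot => None
  | M3top => Some None
  | M3atom i => Some (Some i)
  end.

Definition m3_decode (x : option (option 'I_3)) : m3 :=
  match x with
  | None => M3bot
  | Some None => M3top
  | Some (Some i) => M3atom i
  end.

Lemma m3_codeK : cancel m3_code m3_decode. Proof. by case. Qed.

HB.instance Definition _ := Finite.copy m3 (can_type m3_codeK).

Definition m3_le (x y : m3) : bool :=
  match x, y with
  | M3bot, _ => true
  | _, M3top => true
  | M3atom i, M3atom j => i == j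
  | _, _ => false
  end.

Definition m3_meet (x y : m3) : m3 :=
  match x, y with
  | M3top, z | z, M3top => z
  | M3atom i, M3atom j => if i == j then M3atom i else M3bot
  | _, _ => M3bot
  end.

Definition m3_join (x y : m3) : m3 :=
  match x, y with
  | M3bot, z | z, M3bot => z
  | M3atom i, M3atom j => if i == j then M3atom i else M3top
  | _, _ => M3top
  end.

Lemma m3_le_refl : reflexive m3_le. Proof. by case=> //= i. Qed.

Lemma m3_le_anti : antisymmetric m3_le.
Proof. by case=> [|i|] [|j|] //= /andP[/eqP->]. Qed.

Lemma m3_le_trans : transitive m3_le.
Proof. by case=> [|i|] [|j|] [|k|] //= /eqP->. Qed.

HB.instance Definition _ := Order.Le_isPOrder.Build (Order.Disp tt tt) m3
  m3_le_refl m3_le_anti m3_le_trans.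

Lemma m3_meetP (x y z : m3) : (x <= m3_meet y z) = (x <= y) && (x <= z).
Proof.
rewrite /Order.le /=; move: x y z; case=> [|i|] [|j|] [|k|] //=; rewrite ?andbT //.
- by case: eqP.
- case: (altP (j =P k)) => [->|njk] /=; first by rewrite andbb.
  by symmetry; apply/negP => /andP[/eqP-> /eqP ejk]; rewrite ejk eqxx in njk.
- by case: eqP.
Qed.

Lemma m3_joinP (x y z : m3) : (m3_join x y <= z) = (x <= z) && (y <= z).
Proof.
rewrite /Order.le /=; move: x y z; case=> [|i|] [|j|] [|k|] //=; rewrite ?andbT ?andbF //.
- by case: eqP.
- case: (altP (i =P j)) => [->|nij] /=; first by rewrite andbb.
  by symmetry; apply/negP => /andP[/eqP ei /eqP ej]; rewrite ei ej eqxx in nij.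
- by case: eqP.
Qed.

HB.instance Definition _ :=
  Order.POrder_MeetJoin_isLattice.Build (Order.Disp tt tt) m3
    m3_meetP m3_joinP.

End M3.

Section Definitions.
Context {d : Order.disp_t} {L : finTBLatticeType d}.
Implicit Types (S G : {set L}) (a b x y z : L).

Definition sublattice01 G : Prop :=
  [/\ Order.ClosedPredicates.meet_closed G, Order.ClosedPredicates.join_closed G, \bot \in G & \top \in G].

(* [S], with the meet and join of [L], is a lattice isomorphic to [T]. *)
Definition iso_lattice (d' : Order.disp_t) (T : finLatticeType d') S : Prop :=
  exists f : T -> L,
    [/\ injective f, {morph f : u v / u `&` v}, {morph f : u v / u `|` v}
      & f @: [set: T] = S].

Definition join_irreducible x : Prop :=
  x != \bot /\ forall a b, x = a `|` b -> x = a \/ x = b.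

Definition meet_irreducible x : Prop :=
  x != \top /\ forall a b, x = a `&` b -> x = a \/ x = b.

Definition doubly_irreducible x : Prop :=
  join_irreducible x /\ meet_irreducible x.

(* The interval [a, b] computed in [S]. *)
Definition interval_in S a b : {set L} := [set g in S | a <= g <= b].

(* The largest element of [G] below [x], and the smallest one above [x]; the
   default values are never taken when [G] is a {0,1}-sublattice, see [lowerP]
   and [upperP]. *)
Definition lower G x : L :=
  odflt \bot [pick g in G | (g <= x) && [forall h in G, (h <= x) ==> (h <= g)]].

Definition upper G x : L :=
  odflt \top [pick g in G | (x <= g) && [forall h in G, (x <= h) ==> (g <= h)]].

Lemma lowerP G x : sublattice01 G ->
  [/\ lower G x \in G, lower G x <= x
    & forall h, h \in G -> h <= x -> h <= lower G x].
Proof.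
case=> _ GU G0 _; rewrite /lower; case: pickP => [g /and3P[Gg gx /forall_inP Hg]|] /=.
  by split=> // h Gh hx; apply: implyP hx; apply: Hg.
move/(_ (\join_(g in G | g <= x) g)) => /negP[]; apply/and3P; split.
- by apply: (big_ind (fun g => g \in G)) => // g /andP[].
- by apply/joinsP => g /andP[].
- by apply/forall_inP => h Gh; apply/implyP => hx; apply: (joins_sup id); rewrite Gh.
Qed.

Lemma upperP G x : sublattice01 G ->
  [/\ upper G x \in G, x <= upper G x
    & forall h, h \in G -> x <= h -> upper G x <= h].
Proof.
case=> GI _ _ G1; rewrite /upper; case: pickP => [g /and3P[Gg gx /forall_inP Hg]|] /=.
  by split=> // h Gh hx; apply: implyP hx; apply: Hg.
move/(_ (\meet_(g in G | x <= g) g)) => /negP[]; apply/and3P; split.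
- by apply: (big_ind (fun g => g \in G)) => // g /andP[].
- by apply/meetsP => g /andP[].
- by apply/forall_inP => h Gh; apply/implyP => hx; apply: (meets_inf id); rewrite Gh.
Qed.

Definition is_chain S : bool := [forall x in S, forall y in S, x >=< y].

Definition lattice_length S : nat :=
  (\max_(X : {set L} | (X \subset S) && is_chain X) #|X|).-1.

Definition prime_interval G a b : Prop := #|interval_in G a b| = 2.

Definition prime_square G a b : Prop :=
  lattice_length (interval_in G a b) = 2 /\ iso_lattice (bool *p bool) (interval_in G a b).

Fixpoint modular_poly (n : nat) x y z : L * L * L :=
  if n is n'.+1 then
    let: (p, q, r) := modular_poly n' x y z in
    (p `|` (q `&` r), q `|` (p `&` r), r `|` (p `&` q))
  else (x, y, z).

Definition poly_p n x y z : L := (modular_poly n x y z).1.1.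

End Definitions.

Definition n_modular (n : nat) (d : Order.disp_t) (L : finTBLatticeType d) : Prop :=
  forall x y z : L, poly_p n x y z = poly_p n.+1 x y z.

(* Main.v *)
Require Import Defs.
From mathcomp Require Import all_boot all_order.

(** Write [lo x] and [up x] for the coordinates in [C x D] of the largest grid
element below [x] and of the smallest one above [x].  Two facts about [L] carry
the proof.

- If [x < y] then [up x <= lo y] ([upper_le_lower]): an element strictly above a
  non-grid element [x] is above the upper grid approximation of [x].  Hence the
  order of [L] can be read off [lo] and [up], and incomparable elements have
  their meet and join in the grid, at [lo x /\ lo y] and [up x \/ up y]
  ([incomparable_meet], [incomparable_join]).
- In each coordinate [up x] is at most one step above [lo x]
  ([complemented_gap]): a prime interval and a prime square are complemented,
  whereas a chain with more than two elements is not.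

Now iterate the step [(p, q, r) |-> (p \/ (q /\ r), q \/ (p /\ r), r \/ (p /\ q))]
from a triple [(x, y, z)].  In an arbitrary lattice, two steps from a triple with
a comparable pair lead to a fixed triple ([comparable_pair_settles]).  So at most
three steps are needed as soon as [(x, y, z)] or its image [(X, Y, Z)] has a
comparable pair.  If both are antichains, then [(X, Y, Z)] is already fixed
([antichain_step_fixed]): with [m] the median of [lo x], [lo y], [lo z] in the
distributive lattice [C x D], one has

  [Y /\ Z = lo Y /\ lo Z <= m <= X],

and symmetrically for the other two meets.  The inequality [m <= X] is clear,
since [X] is above [y /\ z], [x /\ y] and [x /\ z].  The inequality
[lo Y /\ lo Z <= m] is checked one coordinate at a time
([meet_le_median_coord]).  In a distributive lattice it would be an instance of
the majority identities; here passing from [y] to [Y] may replace [lo y] by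
[up y \/ (lo x /\ lo z)], and the one-step bound on [up y] is what keeps this
from overshooting the median in both [Y] and [Z]. *)

Set Implicit Arguments.
Unset Strict Implicit.
Unset Printing Implicit Defensive.

Import Order.TTheory.
Local Open Scope order_scope.

(** * Iterating the modular polynomials in an arbitrary lattice *)

Section ModularStep.
Context {d : Order.disp_t} {L : latticeType d}.
Implicit Types (x y z : L) (t : L * L * L).

Definition modular_step t : L * L * L :=
  let: (p, q, r) := t in
  (p `|` (q `&` r), q `|` (p `&` r), r `|` (p `&` q)).

Definition swap12 t : L * L * L := let: (p, q, r) := t in (q, p, r).
Definition swap23 t : L * L * L := let: (p, q, r) := t in (p, r, q).

Lemma modular_step_swap12 t : modular_step (swap12 t) = swap12 (modular_step t).
Proof. by case: t => [[p q] r] /=; rewrite (meetC q p). Qed.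

Lemma modular_step_swap23 t : modular_step (swap23 t) = swap23 (modular_step t).
Proof. by case: t => [[p q] r] /=; rewrite (meetC r q). Qed.

Definition has_comparable_pair t : bool :=
  let: (p, q, r) := t in [|| p >=< q, p >=< r | q >=< r].

Definition settles t : Prop :=
  iter 3 modular_step t = iter 2 modular_step t.

Lemma settles_swap12 t : settles t -> settles (swap12 t).
Proof. by rewrite /settles /= !modular_step_swap12 => ->. Qed.

Lemma settles_swap23 t : settles t -> settles (swap23 t).
Proof. by rewrite /settles /= !modular_step_swap23 => ->. Qed.

(** When [y <= z] the iteration takes place between [y \/ (x /\ z)] and
[(x \/ y) /\ z]: the first step produces the former as middle entry, the second
step raises it to the latter, and nothing moves afterwards. *)
Lemma settles_le x y z : y <= z -> settles (x, y, z).
Proof.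
move=> yz.
have step1 : modular_step (x, y, z) = (x `|` y, y `|` (x `&` z), z).
  rewrite /= (meet_l yz); congr (_, _, _).
  by apply: join_l; apply: le_trans (leIr _ _) yz.
set v := (x `|` y) `&` z.
have le_v : y `|` (x `&` z) <= v.
  by rewrite leUx !lexI leUr yz leIr andbT /= lexU2 // leIl.
have vxy : v <= x `|` y by apply: leIl.
have vz : v <= z by apply: leIr.
have step2 : modular_step (x `|` y, y `|` (x `&` z), z) = (x `|` y, v, z).
  rewrite /= -/v; congr (_, _, _); last by apply: join_l; rewrite leIxr // (le_trans le_v).
    by apply: join_l; rewrite leIxl // (le_trans le_v).
  exact: join_r.
have step3 : modular_step (x `|` y, v, z) = (x `|` y, v, z).
  rewrite /= -/v joinxx; congr (_, _, _); apply: join_l.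
    by rewrite leIxl.
  by rewrite leIxr.
by rewrite /settles !iterS /iter step1 step2 step3.
Qed.

Lemma comparable_pair_settles t : has_comparable_pair t -> settles t.
Proof.
have cmp23 x y z : y >=< z -> settles (x, y, z).
  case/orP=> [yz | zy]; first exact: settles_le.
  exact: (settles_swap23 (settles_le x zy)).
case: t => [[p q] r] /or3P[pq | pr | qr].
- by apply: (settles_swap23 (t := (p, r, q))); apply: (settles_swap12 (t := (r, p, q))); apply: cmp23.
- by apply: (settles_swap12 (t := (q, p, r))); apply: cmp23.
- exact: cmp23.
Qed.

End ModularStep.

(** * The median inequality, one coordinate at a time *)

Section Chains.
Context {d1 d2 : Order.disp_t} {C : orderType d1} {D : orderType d2}.

(** Here [x], [y], [z] stand for [lo x], [lo y], [lo z], while [v], [w] stand for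
[up y], [up z]; the indices are the coordinates, and the two conditionals are the
first coordinates of [lo Y] and [lo Z].  If both exceeded the median [m] of
[x1], [y1], [z1], then [y1] and [z1] would be at least [m], because [v1] and [w1]
are at most one step above them, but they cannot both be larger.  Say [y1 = m]: the
conditional for [Y] can only exceed [m] by failing in the second coordinate,
where [y] is then strictly below [x] and [z].  As [y] is not below [z], this
forces [z1 = m], and the same argument puts [z] strictly below [y] in the second
coordinate, which is absurd. *)
Lemma meet_le_median_coord (x1 y1 z1 v1 w1 : C) (x2 y2 z2 v2 w2 : D) :
    (forall t, y1 < t -> v1 <= t) -> (forall t, z1 < t -> w1 <= t) ->
    (forall t, y2 < t -> v2 <= t) -> (forall t, z2 < t -> w2 <= t) ->
    ~~ ((v1 <= z1) && (v2 <= z2)) -> ~~ ((w1 <= y1) && (w2 <= y2)) ->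
  (if (x1 `&` z1 <= y1) && (x2 `&` z2 <= y2) then y1
   else v1 `|` (x1 `&` z1))
  `&` (if (x1 `&` y1 <= z1) && (x2 `&` y2 <= z2) then z1
       else w1 `|` (x1 `&` y1))
  <= (y1 `&` z1) `|` (x1 `&` z1) `|` (x1 `&` y1).
Proof.
move=> gy1 gz1 gy2 gz2 nyz nzy.
set Y1 := (X in X `&` _); set Z1 := (X in _ `&` X); set m := (X in _ <= X).
have le_m : [/\ y1 `&` z1 <= m, x1 `&` z1 <= m & x1 `&` y1 <= m].
  by rewrite /m; split; rewrite !lexU lexx ?orbT.
case: le_m => yzm xzm xym.
rewrite leNgt; apply/negP; rewrite ltxI => /andP[mY mZ].
have my : m <= y1.
  move: mY; rewrite /Y1; case: ifP => _; first exact: ltW.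
  rewrite ltxU [m < _ `&` _]ltNge xzm orbF ltNge => /negP nv.
  by rewrite leNgt; apply/negP => /gy1.
have mz : m <= z1.
  move: mZ; rewrite /Z1; case: ifP => _; first exact: ltW.
  rewrite ltxU [m < _ `&` _]ltNge xym orbF ltNge => /negP nv.
  by rewrite leNgt; apply/negP => /gz1.
have y2z2 : y1 <= m -> (y2 < x2) && (y2 < z2).
  move=> ym; move: mY; rewrite /Y1 (le_trans xzm my) /= leNgt ltxI.
  by case: ifP => [_|/negbFE //]; rewrite ltNge ym.
have z2y2 : z1 <= m -> (z2 < x2) && (z2 < y2).
  move=> zm; move: mZ; rewrite /Z1 (le_trans xym mz) /= leNgt ltxI.
  by case: ifP => [_|/negbFE //]; rewrite ltNge zm.
case: (leP y1 m) => [ym | lt_my].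
  have /andP[_ lt2] := y2z2 ym.
  case: (leP z1 m) => [/z2y2/andP[_ /lt_trans/(_ lt2)] | lt_mz]; first by rewrite ltxx.
  by case/negP: nyz; rewrite gy1 ?gy2 // (le_lt_trans ym).
case: (leP z1 m) => [zm | lt_mz].
  have /andP[_ lt2] := z2y2 zm.
  by case/negP: nzy; rewrite gz1 ?gz2 // (le_lt_trans zm).
by have := lt_le_trans (_ : m < y1 `&` z1) yzm; rewrite ltxI lt_my lt_mz ltxx => /(_ isT).
Qed.

End Chains.

(** * Lattices approximated by a product of two chains *)

Section Gridded.
Context {d dC dD : Order.disp_t} {L : latticeType d}.
Context {C : orderType dC} {D : orderType dD}.

(** All that the argument needs to know about [L]: [f] embeds the grid, and [lo],
[up] are the coordinates of the grid approximations.  The last two fields say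
that [up x] is at most one step above [lo x] in each coordinate. *)
Record gridded (f : C *p D -> L) (lo up : L -> C *p D) : Prop := Gridded {
  grid_meet : {morph f : s t / s `&` t};
  grid_join : {morph f : s t / s `|` t};
  lo_grid : forall t, lo (f t) = t;
  up_grid : forall t, up (f t) = t;
  grid_lo_le : forall x, f (lo x) <= x;
  le_grid_up : forall x, x <= f (up x);
  up_le_lo : forall x y, x < y -> up x <= lo y;
  gap1 : forall x c, (lo x).1 < c -> (up x).1 <= c;
  gap2 : forall x c, (lo x).2 < c -> (up x).2 <= c
}.

Variables (f : C *p D -> L) (lo up : L -> C *p D).
Hypothesis F : gridded f lo up.
Implicit Types (x y z : L) (s t : C *p D).

Lemma grid_le s t : s <= t -> f s <= f t.
Proof. by move=> /meet_idPl st; rewrite leEmeet -(grid_meet F) st. Qed.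

Lemma grid_leE s x : (f s <= x) = (s <= lo x).
Proof.
apply/idP/idP => [|/grid_le sx]; last exact: le_trans sx (grid_lo_le F x).
rewrite le_eqVlt => /predU1P[<-|/(up_le_lo F)]; last by rewrite (up_grid F).
by rewrite (lo_grid F).
Qed.

Lemma up_le_lo_le x y : up x <= lo y -> x <= y.
Proof.
by move=> /grid_le xy; apply: le_trans (le_grid_up F x) (le_trans xy (grid_lo_le F y)).
Qed.

Lemma incomparable_meet x y : x >< y -> x `&` y = f (lo x `&` lo y).
Proof.
rewrite negb_or => /andP[nxy nyx]; apply/le_anti/andP; split; last first.
  by rewrite (grid_meet F) leI2 // (grid_lo_le F).
apply: le_trans (le_grid_up F _) _; apply: grid_le; rewrite lexI !(up_le_lo F) //.
  by rewrite lt_neqAle eq_meetr nyx leIr.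
by rewrite lt_neqAle eq_meetl nxy leIl.
Qed.

Lemma incomparable_join x y : x >< y -> x `|` y = f (up x `|` up y).
Proof.
rewrite negb_or => /andP[nxy nyx]; apply/le_anti/andP; split.
  by rewrite (grid_join F) leU2 // (le_grid_up F).
rewrite grid_leE leUx !(up_le_lo F) //.
  by rewrite lt_neqAle eq_sym eq_joinr nxy leUr.
by rewrite lt_neqAle eq_sym eq_joinl nyx leUl.
Qed.

(** When [x /\ z] is not below [y], it is incomparable to [y], for [y <= x /\ z]
would make [y] comparable to [x]; so the join falls into the grid. *)
Lemma lo_modular_step x y z : y >< x -> y >< z -> x >< z ->
  lo (y `|` (x `&` z)) =
    if lo x `&` lo z <= lo y then lo y else up y `|` (lo x `&` lo z).
Proof.
move=> yx yz xz; rewrite (incomparable_meet xz).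
case: ifPn => [|nle]; first by rewrite -grid_leE => /join_l ->.
rewrite incomparable_join ?(lo_grid F) ?(up_grid F) // negb_or grid_leE nle andbT.
rewrite -(incomparable_meet xz) lexI negb_and.
by move: yx; rewrite negb_or => /andP[-> _].
Qed.

(** Both sides are compared with the median [m] of [lo x], [lo y], [lo z], whose
image in [L] is the join of the three pairwise meets of [x], [y], [z]. *)
Lemma modular_step_meet_le x y z : ~~ has_comparable_pair (x, y, z) ->
    y `|` (x `&` z) >< z `|` (x `&` y) ->
  (y `|` (x `&` z)) `&` (z `|` (x `&` y)) <= x `|` (y `&` z).
Proof.
move=> /norP[xy /norP[xz yz]] YZ.
have yx : y >< x by rewrite comparable_sym.
have zx : z >< x by rewrite comparable_sym.
have zy : z >< y by rewrite comparable_sym.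
rewrite (incomparable_meet YZ) (lo_modular_step yx yz xz) (lo_modular_step zx zy xy).
set m := (lo y `&` lo z) `|` (lo x `&` lo z) `|` (lo x `&` lo y).
apply: (@le_trans _ _ (f m)); last first.
  rewrite !(grid_join F) -!incomparable_meet // !leUx leUr /=.
  by rewrite !(le_trans (leIl _ _) (leUl _ _)).
have nle u v : u >< v -> ~~ (((up u).1 <= (lo v).1) && ((up u).2 <= (lo v).2)).
  by move=> uv; apply: contra uv => /up_le_lo_le; rewrite /Order.comparable => ->.
have := meet_le_median_coord (lo x).1 (lo x).2 (gap1 F (x := y)) (gap1 F (x := z))
  (gap2 F (x := y)) (gap2 F (x := z)) (nle _ _ yz) (nle _ _ zy).
have := meet_le_median_coord (lo x).2 (lo x).1 (gap2 F (x := y)) (gap2 F (x := z))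
  (gap1 F (x := y)) (gap1 F (x := z)).
(* The second coordinate is the first one with [C] and [D] exchanged. *)
rewrite ![((up _).2 <= _) && _]andbC => /(_ (nle _ _ yz) (nle _ _ zy)).
rewrite ![(_ `&` _ <= (lo _).2) && _]andbC /=.
move=> H2 H1; apply: grid_le; move: H2 H1; rewrite /m !leEprod !meetEprod !joinEprod /=.
by case: (_ && _); case: (_ && _) => /= H2 H1; rewrite H1 H2.
Qed.

Lemma antichain_step_fixed x y z : let t := modular_step (x, y, z) in
    ~~ has_comparable_pair (x, y, z) -> ~~ has_comparable_pair t ->
  modular_step t = t.
Proof.
move=> t xyz /norP[XY /norP[XZ YZ]]; have /norP[xy /norP[xz yz]] := xyz.
rewrite /t /modular_step.
congr (_, _, _); apply: join_l.
- exact: modular_step_meet_le.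
- have /= := @modular_step_meet_le y x z; rewrite (meetC y x); apply=> //.
  by rewrite /has_comparable_pair comparable_sym; apply/norP; split=> //; apply/norP.
- have /= := @modular_step_meet_le z x y; rewrite (meetC z x) (meetC z y); apply=> //.
  by rewrite /has_comparable_pair ![z >=< _]comparable_sym; apply/norP; split=> //; apply/norP.
Qed.

Lemma gridded_iter_step_fixed (x y z : L) :
  iter 3 modular_step (x, y, z) = iter 4 modular_step (x, y, z).
Proof.
have [/comparable_pair_settles st|nxyz] := boolP (has_comparable_pair (x, y, z)).
  by rewrite [RHS]iterS st -iterS st.
have [/comparable_pair_settles st|nXYZ] := boolP (has_comparable_pair (modular_step (x, y, z))).
  by rewrite (iterSr 3) (iterSr 2) st.
by rewrite (iterSr 3) (iterSr 2) !(iter_fix _ (antichain_step_fixed nxyz nXYZ)).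
Qed.

End Gridded.

(** * Grid approximations in the lattice *)

Lemma upper_id (d : Order.disp_t) (L : finTBLatticeType d) (G : {set L}) x :
  sublattice01 G -> x \in G -> upper G x = x.
Proof.
by move=> G01 Gx; have [_ xu le] := upperP x G01; apply/le_anti; rewrite xu le // lexx.
Qed.

Lemma lower_id (d : Order.disp_t) (L : finTBLatticeType d) (G : {set L}) x :
  sublattice01 G -> x \in G -> lower G x = x.
Proof.
by move=> G01 Gx; have [_ lx ge] := lowerP x G01; apply/le_anti; rewrite lx ge // lexx.
Qed.

Section Grid.
Context {d : Order.disp_t} {L : finTBLatticeType d}.
Variable G : {set L}.
Hypothesis G01 : sublattice01 G.

(** Suppose [x] is not in the grid, and let [w := y /\ upper G x], so that
[x <= w <= upper G x].  If [w] is in the grid, it equals [upper G x], which is thus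
below [y].  Otherwise [w] has the same upper approximation as [x], hence [w = x];
meet irreducibility then gives [x = y] or [x = upper G x], both impossible. *)
Lemma upper_le_lower x y :
    (forall x : L, x \notin G -> meet_irreducible x) ->
    (forall x y : L, x \notin G -> y \notin G -> upper G x = upper G y -> x = y) ->
  x < y -> upper G x <= lower G y.
Proof.
move=> irr upper_inj xy.
have [Gux xux le_ux] := upperP x G01; have [_ _ ge_ly] := lowerP y G01.
apply: (ge_ly) => //.
have [Gx|nGx] := boolP (x \in G); first by rewrite upper_id // ltW.
set w := y `&` upper G x.
have xw : x <= w by rewrite lexI xux ltW.
have wu : w <= upper G x by apply: leIr.
have [Gw|nGw] := boolP (w \in G); first exact: le_trans (le_ux _ Gw xw) (leIl _ _).
have [_ ww le_uw] := upperP w G01.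
have /esym xE : w = x.
  apply: upper_inj => //; apply/le_anti; rewrite le_uw //= le_ux ?(le_trans xw) //.
  by have [] := upperP w G01.
have [_ /(_ _ _ xE)[xEy|xEu]] := irr x nGx; first by rewrite xEy ltxx in xy.
by rewrite xEu Gux in nGx.
Qed.

(** The common feature of prime intervals and prime squares. *)
Definition complemented a b : Prop :=
  forall g, g \in interval_in G a b ->
    exists2 h, h \in interval_in G a b & g `&` h = a /\ g `|` h = b.

Lemma prime_interval_complemented a b : a \in G -> b \in G -> a <= b ->
  prime_interval G a b -> complemented a b.
Proof.
move=> Ga Gb ab card2 g gab.
have Ia : a \in interval_in G a b by rewrite inE Ga lexx ab.
have Ib : b \in interval_in G a b by rewrite inE Gb lexx ab.
have [gEa|ga] := eqVneq g a; first by exists b => //; rewrite gEa (meet_l ab) (join_r ab).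
have [gEb|gb] := eqVneq g b; first by exists a => //; rewrite gEb (meet_r ab) (join_l ab).
have : a != b.
  by apply: contraNneq ga => eab; move: gab; rewrite inE -eab eq_le => /and3P[_ -> ->].
move=> nab; have : uniq [:: a; b; g] by rewrite /= !inE negb_or nab eq_sym ga eq_sym gb.
move=> /card_uniqP cE; have : #|[:: a; b; g]| <= #|interval_in G a b|.
  by apply/subset_leq_card/subsetP => t; rewrite !inE => /or3P[] /eqP->; move: Ia Ib gab; rewrite !inE.
by rewrite cE card2.
Qed.

Lemma iso_bool2_complemented a b : a \in G -> b \in G -> a <= b ->
  iso_lattice (bool *p bool) (interval_in G a b) -> complemented a b.
Proof.
move=> Ga Gb ab [f [_ fI fU imf]] g gab.
have f_in t : f t \in interval_in G a b by rewrite -imf imset_f.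
have Ia : a \in interval_in G a b by rewrite inE Ga lexx ab.
have Ib : b \in interval_in G a b by rewrite inE Gb lexx ab.
move: gab Ia Ib; rewrite -{1 2 3}imf.
move=> /imsetP[t _ ->] /imsetP[ta _ aE] /imsetP[tb _ bE].
exists (f (~~ t.1, ~~ t.2)) => //.
split; apply/le_anti.
  have -> : f t `&` f (~~ t.1, ~~ t.2) = a `&` f (t `&` (~~ t.1, ~~ t.2)).
    by rewrite -fI aE -fI; congr f; case: t ta {aE} => [[] []] [[] []].
  by rewrite leIl lexI lexx; move: (f_in (t `&` (~~ t.1, ~~ t.2))); rewrite inE => /and3P[_ ->].
have -> : f t `|` f (~~ t.1, ~~ t.2) = b `|` f (t `|` (~~ t.1, ~~ t.2)).
  by rewrite -fU bE -fU; congr f; case: t tb {bE} => [[] []] [[] []].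
by rewrite leUl leUx lexx andbT; move: (f_in (t `|` (~~ t.1, ~~ t.2))); rewrite inE => /and3P[_ _ ->].
Qed.

End Grid.

Lemma chain_complement (d' : Order.disp_t) (T : orderType d') (a b g h : T) :
  a < g -> g `&` h = a -> g `|` h = b -> b <= g.
Proof.
by move=> ag + <-; case: (leP g h) => // _ ga; rewrite ga ltxx in ag.
Qed.

Section Coordinates.
Context {d dC dD : Order.disp_t} {L : finTBLatticeType d} (G : {set L}).
Context {C : finOrderType dC} {D : finOrderType dD} (f : C *p D -> L).
Hypotheses (f_inj : injective f) (f_meet : {morph f : s t / s `&` t}).
Hypotheses (f_join : {morph f : s t / s `|` t}) (f_im : f @: [set: C *p D] = G).

(** A value [c] strictly between the first coordinates of [s] and [t] would give
the element [(c, s.2)] of the interval; the first coordinate of a complement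
would complement [c] in the chain between [s.1] and [t.1]. *)
Lemma complemented_gap s t : s <= t -> complemented G (f s) (f t) ->
  (forall c, s.1 < c -> t.1 <= c) /\ (forall c, s.2 < c -> t.2 <= c).
Proof.
move=> st compl.
have f_le u v : u <= v -> f u <= f v by move=> /meet_idPl uv; rewrite leEmeet -f_meet uv.
have fG u : f u \in G by rewrite -f_im imset_f.
have coord g : s <= g <= t -> exists h, g `&` h = s /\ g `|` h = t.
  case/andP=> sg gt; case: (compl (f g)); first by rewrite inE fG !f_le.
  move=> h; rewrite inE -f_im => /andP[/imsetP[h' _ ->] _].
  by rewrite -f_meet -f_join => -[/f_inj gh /f_inj gh']; exists h'.
move: st coord; rewrite leEprod => /andP[st1 st2] coord; split=> c sc.
  case: (leP t.1 c) => // ct; have := coord (c, s.2).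
  rewrite !leEprod /= (ltW sc) (ltW ct) st2 lexx => /(_ isT)[h [/(congr1 fst) mh /(congr1 fst) jh]].
  by have := chain_complement sc mh jh; rewrite leNgt ct.
case: (leP t.2 c) => // ct; have := coord (s.1, c).
rewrite !leEprod /= (ltW sc) (ltW ct) st1 lexx => /(_ isT)[h [/(congr1 snd) mh /(congr1 snd) jh]].
by have := chain_complement sc mh jh; rewrite leNgt ct.
Qed.

End Coordinates.

Theorem theorem7 (d dC dD : Order.disp_t) (L : finTBLatticeType d)
    (G : {set L}) (C : finOrderType dC) (D : finOrderType dD)
    (C1 : sublattice01 G /\ iso_lattice (C *p D) G)
    (C2 : forall x : L, x \notin G -> doubly_irreducible x)
    (C3 : forall x y : L, x \notin G -> y \notin G ->
       (lower G x = lower G y -> x = y) /\ (upper G x = upper G y -> x = y))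
    (C4 : forall x : L, x \notin G ->
       (prime_interval G (lower G x) (upper G x) /\
        iso_lattice 'I_3 (interval_in [set: L] (lower G x) (upper G x)))
       \/
       (prime_square G (lower G x) (upper G x) /\
        iso_lattice m3 (interval_in [set: L] (lower G x) (upper G x)))) :
  n_modular 3 L.
Proof.
case: C1 => G01 [f [f_inj f_meet f_join f_im]].
have ex_lo x : exists t, f t = lower G x.
  have [] := lowerP x G01.
  by rewrite -f_im => /imsetP[t _ ->]; exists t.
have [lo loE] := fin_all_exists ex_lo.
have ex_up x : exists t, f t = upper G x.
  have [] := upperP x G01.
  by rewrite -f_im => /imsetP[t _ ->]; exists t.
have [up upE] := fin_all_exists ex_up.
have fG t : f t \in G by rewrite -f_im imset_f.
have f_le s t : (f s <= f t) = (s <= t) by rewrite !leEmeet -f_meet (inj_eq f_inj).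
have lo_le_up x : lo x <= up x.
  rewrite -f_le loE upE; have [_ lx _] := lowerP x G01; have [_ xu _] := upperP x G01.
  exact: le_trans lx xu.
have gaps x : (forall c, (lo x).1 < c -> (up x).1 <= c) /\
              (forall c, (lo x).2 < c -> (up x).2 <= c).
  have [Gx|nGx] := boolP (x \in G).
    have -> : up x = lo x by apply: f_inj; rewrite loE upE lower_id ?upper_id.
    by split=> c /ltW.
  apply: (complemented_gap f_inj f_meet f_join f_im (lo_le_up x)); rewrite loE upE.
  have [Gl lx _] := lowerP x G01; have [Gu xu _] := upperP x G01.
  have lu := le_trans lx xu.
  case: (C4 x nGx) => -[] => [p _|[_ p] _].
    exact: prime_interval_complemented.
  exact: iso_bool2_complemented.
have L_gridded : gridded f lo up.
  split=> //.
  - by move=> t; apply: f_inj; rewrite loE lower_id.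
  - by move=> t; apply: f_inj; rewrite upE upper_id.
  - by move=> x; rewrite loE; have [] := lowerP x G01.
  - by move=> x; rewrite upE; have [] := upperP x G01.
  - move=> x y xy; rewrite -f_le loE upE; apply: upper_le_lower => // [u /C2[] //|u v nGu nGv].
    by case: (C3 u v nGu nGv).
  - by move=> x; case: (gaps x).
  - by move=> x; case: (gaps x).
have polyE n (x y z : L) : modular_poly n x y z = iter n modular_step (x, y, z).
  by elim: n => //= n ->.
by move=> x y z; rewrite /poly_p !polyE (gridded_iter_step_fixed L_gridded).
Qed.
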